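(* Let $R$ be a commutative ring containing $\mathbb{Q}$, let $\mathbf{k}=(k_1,\dots,k_m)$ be a tuple of positive integers of weight $w=k_1+\cdots+k_m$, and let $N$ be a positive integer. Put $l_1=k_1$, $l_2=k_1+k_2$, $\dots$, $l_m=k_1+\cdots+k_m=w$. Then the following polynomial identities hold in $R[t_1,\dots,t_m]$: $$\sum_{N\ge n_1\ge\cdots\ge n_m\ge1}(-1)^{n_1}\binom{N}{n_1}\frac{t_1^{n_1-n_2}\cdots t_{m-1}^{n_{m-1}-n_m}t_m^{n_m}}{n_1^{k_1}\cdots n_m^{k_m}}$$ $$=\sum_{N\ge n_1\ge\cdots\ge n_w\ge1}\frac{(1-t_1)^{n_{l_1}-n_{l_1+1}}\cdots(1-t_{m-1})^{n_{l_{m-1}}-n_{l_{m-1}+1}}\{(1-t_m)^{n_{l_m}}-1\}}{n_1\cdots n_w},$$ and $$\sum_{N\ge n_1\ge\cdots\ge n_m\ge1}\frac{t_1^{n_1-n_2}\cdots t_{m-1}^{n_{m-1}-n_m}t_m^{n_m}}{n_1^{k_1}\cdots n_m^{k_m}}$$ $$=\sum_{N\ge n_1\ge\cdots\ge n_w\ge1}(-1)^{n_1}\binom{N}{n_1}\frac{(1-t_1)^{n_{l_1}-n_{l_1+1}}\cdots(1-t_{m-1})^{n_{l_{m-1}}-n_{l_{m-1}+1}}\{(1-t_m)^{n_{l_m}}-1\}}{n_1\cdots n_w}.$$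
   Context: All summation variables $n_i$ are integers; a zeroth power is the constant polynomial $1$. *)

(* Defs.v *)
From HB Require Import structures.
From mathcomp Require Export all_boot all_order all_algebra.
From mathcomp Require Export mpoly.

Set Implicit Arguments.
Unset Strict Implicit.
Unset Printing Implicit Defensive.

Import GRing.Theory.
Local Open Scope ring_scope.

(* A number of variables m >= 1 is written m'.+1.  All indices below are
   1-based, as in (n_1, ..., n_p), (t_1, ..., t_m), (l_1, ..., l_m). *)

(* s_j; only meaningful for 1 <= j <= size s *)
Definition entry (s : seq nat) (j : nat) : nat := nth 0%N s j.-1.

(* An index vector (n_1, ..., n_p) with all n_i <= N, as a list of naturals. *)
Definition ints (N p : nat) (n : p.-tuple 'I_N.+1) : seq nat :=
  [seq nat_of_ord i | i <- n].

(* N >= n_1 >= ... >= n_p >= 1: geq holds between successive terms of the list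
   N, n_1, ..., n_p, 1. *)
Definition chain (N : nat) (s : seq nat) : bool := path geq N (rcons s 1%N).

(* l_i = k_1 + ... + k_i *)
Definition psum (k : seq nat) (i : nat) : nat := sumn (take i k).

(* t_i; only meaningful for 1 <= i <= m'.+1 *)
Definition tvar (R : nzRingType) (m' i : nat) : {mpoly R[m'.+1]} :=
  'X_(inord i.-1).

Section Monomials.
Variables (R : comNzRingType) (m' : nat).
Local Notation m := m'.+1.
Local Notation t := (tvar R m').

(* The exponents are natural-number subtractions; no truncation occurs when
   the list is a chain. *)
Definition tmono (n : seq nat) : {mpoly R[m]} :=
  (\prod_(1 <= i < m) t i ^+ (entry n i - entry n i.+1)) * t m ^+ entry n m.

Definition one_sub_tmono (k n : seq nat) : {mpoly R[m]} :=
  (\prod_(1 <= i < m)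
     (1 - t i) ^+ (entry n (psum k i) - entry n (psum k i).+1))
  * ((1 - t m) ^+ entry n (psum k m) - 1).

End Monomials.

(* 1 / (n_1^{k_1} ... n_p^{k_p}), with p = size k *)
Definition inv_powers (k n : seq nat) : rat :=
  (\prod_(1 <= i < (size k).+1) (entry n i)%:R ^+ entry k i)^-1.

(* 1 / (n_1 ... n_p), with p = size n *)
Definition inv_prod (n : seq nat) : rat :=
  (\prod_(1 <= i < (size n).+1) (entry n i)%:R)^-1.

Definition sbin (N : nat) (n : seq nat) : rat :=
  (-1) ^+ entry n 1 * 'C(N, entry n 1)%:R.

(* Main.v *)
Require Import Defs.
From mathcomp Require Import ring.

Set Implicit Arguments.
Unset Strict Implicit.
Unset Printing Implicit Defensive.

Import GRing.Theory.
Local Open Scope ring_scope.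

(** Both identities are instances of one duality for the binomial transform
    (B f)(N) = \sum_(j <= N) (-1)^j C(N, j) f(j), which is taken of sequences
    f with f(0) = 0.

    Let (T_a h)(N) = \sum_(j <= N) a^(N-j) h(j) ([geom_sum]) and
    (D f)(n) = f(n) / n ([div_index]).  Then B T_a D = T_(1-a) D B
    ([binomial_transform_geom_sum_div]): the sequence g = T_a D f is determined
    by the recursion g(n+1) = a g(n) + f(n+1) / (n+1), and Pascal's rule turns
    it into the recursion with 1 - a in place of a, the index in the
    denominator being absorbed by (j+1) C(N+1, j+1) = (N+1) C(N, j).  Hence B
    carries a word T_(a_1) D T_(a_2) D ... applied to f to the word with
    letters 1 - a_i applied to B f.

    Summing over chains one entry at a time shows that a chain sum with powers
    of gaps between entries is the value at N of such a word
    ([sum_chain_word]): the sum over m-chains is the word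
    T_1 D^(k_1) T_(t_1) D^(k_2) ... T_(t_(m-1)) D^(k_m) applied to the sequence
    t_m^n - 0^n.  As T_0 is the identity, D^(k_i) = D (T_0 D)^(k_i - 1), so
    this is a word in w letters, all but m of them equal to 0
    ([word_expand]).  Complementing every letter gives 1 - t_i at position
    l_i + 1 and 1 at the filler positions, which is the sum over w-chains; and
    B maps t_m^n - 0^n to (1 - t_m)^n - 1 ([binomial_transform_pow_diff]).

    The weight (-1)^(n_1) C(N, n_1) on a chain sum means that the outermost
    summation is B instead of T_1.  Thus such a sum is B of a word that starts
    with T_0, and complementing that letter produces the unweighted sum on the
    other side; this works in either direction and gives the two
    identities. *)

Section Words.

Variables (A : comNzRingType) (phi : {rmorphism rat -> A}).
Implicit Types (a b z : A) (f h : nat -> A) (s : seq (A * nat)).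

(** * Geometric sums, division by the index, and the binomial transform *)

Definition geom_sum a h (N : nat) : A := \sum_(j < N.+1) a ^+ (N - j) * h j.

(** The value at 0 is 0, because the inverse of 0 in [rat] is 0. *)
Definition div_index f (n : nat) : A := phi n%:R^-1 * f n.

Definition signed_bin (N j : nat) : A := (-1) ^+ j * 'C(N, j)%:R.

Definition binomial_transform f (N : nat) : A :=
  \sum_(j < N.+1) signed_bin N j * f j.

(** A letter (a, k) stands for the operator T_a D^k. *)
Definition word s f : nat -> A :=
  foldr (fun l g => geom_sum l.1 (iter l.2 div_index g)) f s.

(** The innermost factors of both sides have this form: t^n - 0^n and
    (1 - t)^n - 1^n.  The family is stable under the binomial transform and,
    unlike the pure powers, vanishes at 0. *)
Definition pow_diff a b (n : nat) : A := a ^+ n - b ^+ n.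

Definition dual s := [seq (1 - l.1, l.2) | l <- s].

(** For z = 0 this rewrites T_a D^k as T_a D (T_0 D)^(k-1); z = 1 is the image
    of that expansion under [dual]. *)
Definition expand z s : seq (A * nat) :=
  flatten [seq (l.1, 1%N) :: nseq l.2.-1 (z, 1%N) | l <- s].

Lemma geom_sum0 a h : geom_sum a h 0 = h 0%N.
Proof. by rewrite /geom_sum big_ord1 expr0 mul1r. Qed.

Lemma geom_sumS a h N : geom_sum a h N.+1 = a * geom_sum a h N + h N.+1.
Proof.
rewrite /geom_sum big_ord_recr /= subnn expr0 mul1r mulr_sumr /=.
congr (_ + _); apply: eq_bigr => j _.
by rewrite subSn ?exprS ?mulrA // -ltnS.
Qed.

Lemma eq_geom_sum a f h : f =1 h -> geom_sum a f =1 geom_sum a h.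
Proof. by move=> efh N; apply: eq_bigr => j _; rewrite efh. Qed.

Lemma geom_sum_zero h : geom_sum 0 h =1 h.
Proof. by case=> [|N]; rewrite ?geom_sum0 // geom_sumS mul0r add0r. Qed.

Lemma geom_sum_one h N : geom_sum 1 h N = \sum_(j < N.+1) h j.
Proof. by apply: eq_bigr => j _; rewrite expr1n mul1r. Qed.

Lemma div_index0 f : div_index f 0 = 0.
Proof. by rewrite /div_index invr0 rmorph0 mul0r. Qed.

Lemma iter_div_index k f n :
  iter k div_index f n = phi (n%:R^-1 ^+ k) * f n.
Proof.
elim: k => [|k IHk] /=; first by rewrite expr0 rmorph1 mul1r.
by rewrite {1}/div_index IHk exprS rmorphM mulrA.
Qed.

(** Pascal's rule. *)
Lemma binomial_transformS f N :
  binomial_transform f N.+1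
  = binomial_transform f N - binomial_transform (fun n => f n.+1) N.
Proof.
rewrite /binomial_transform /signed_bin.
have -> : \sum_(j < N.+1) (-1) ^+ j * 'C(N, j)%:R * f j =
    \sum_(j < N.+2) (-1) ^+ j * 'C(N, j)%:R * f j.
  by rewrite [RHS]big_ord_recr /= bin_small // mulr0 mul0r addr0.
rewrite big_ord_recl [in RHS]big_ord_recl -addrA !bin0; congr (_ + _).
rewrite -sumrB; apply: eq_bigr => j _.
by rewrite lift0 /= binS natrD exprS; ring.
Qed.

Lemma eq_binomial_transform f h :
  f =1 h -> binomial_transform f =1 binomial_transform h.
Proof. by move=> efh N; apply: eq_bigr => j _; rewrite efh. Qed.

Lemma binomial_transform0 f : binomial_transform f 0 = f 0%N.
Proof. by rewrite /binomial_transform big_ord1 /signed_bin expr0 bin0 !mul1r. Qed.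

Lemma binomial_transform_comb c f h N :
  binomial_transform (fun n => c * f n + h n) N
  = c * binomial_transform f N + binomial_transform h N.
Proof.
rewrite /binomial_transform mulr_sumr -big_split /=.
by apply: eq_bigr => j _; ring.
Qed.

(** This is (j+1) C(N+1, j+1) = (N+1) C(N, j) summed against f; the hypothesis
    removes the missing term j = 0 on the right. *)
Lemma binomial_transform_absorption f N : f 0%N = 0 ->
  binomial_transform (fun n => div_index f n.+1) N
  = - div_index (binomial_transform f) N.+1.
Proof.
move=> f0; rewrite {2}/div_index /binomial_transform.
rewrite [in RHS]big_ord_recl f0 mulr0 add0r.
rewrite -mulrN -sumrN [RHS]mulr_sumr; apply: eq_bigr => j _.
rewrite /div_index /signed_bin lift0 /= exprS -[LHS]mulrA.
have -> : 'C(N, j)%:R * (phi j.+1%:R^-1 * f j.+1)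
        = phi ('C(N, j)%:R * j.+1%:R^-1) * f j.+1 :> A.
  by rewrite rmorphM rmorph_nat mulrA.
have -> : 'C(N, j)%:R * j.+1%:R^-1 = N.+1%:R^-1 * 'C(N.+1, j.+1)%:R :> rat.
  have nz (i : nat) : i.+1%:R != 0 :> rat by rewrite Num.Theory.pnatr_eq0.
  apply: (mulfI (nz N)); apply: (mulIf (nz j)).
  rewrite !mulrA divff // mul1r mulfVK //.
  by rewrite -!natrM mul_bin_diag mulnC.
by rewrite rmorphM rmorph_nat; ring.
Qed.

(** The commutation rule B T_a D = T_(1-a) D B: both sides satisfy
    y(N+1) = (1 - a) y(N) + (B f)(N+1) / (N+1), by Pascal's rule and absorption
    for the left one. *)
Lemma binomial_transform_geom_sum_div a f : f 0%N = 0 ->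
  binomial_transform (geom_sum a (div_index f))
  =1 geom_sum (1 - a) (div_index (binomial_transform f)).
Proof.
move=> f0; elim=> [|N IHN].
  by rewrite binomial_transform0 !geom_sum0 !div_index0.
rewrite binomial_transformS (eq_binomial_transform (geom_sumS a _)).
rewrite binomial_transform_comb binomial_transform_absorption // geom_sumS -IHN.
by ring.
Qed.

Lemma binomial_transform_pow_diff a b :
  binomial_transform (pow_diff a b) =1 pow_diff (1 - a) (1 - b).
Proof.
have pow c N : binomial_transform (GRing.exp c) N = (1 - c) ^+ N.
  elim: N => [|N IHN]; first by rewrite binomial_transform0.
  rewrite binomial_transformS exprS -IHN mulrBl mul1r; congr (_ - _).
  rewrite /binomial_transform mulr_sumr; apply: eq_bigr => j _ /=.
  by rewrite exprS; ring.
move=> N; rewrite /pow_diff -!pow /binomial_transform -sumrB.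
by apply: eq_bigr => j _; rewrite mulrBr.
Qed.

Lemma pow_diff0 a b : pow_diff a b 0 = 0.
Proof. by rewrite /pow_diff subrr. Qed.

(** * Duality of words *)

Lemma eq_word s f h : f =1 h -> word s f =1 word s h.
Proof.
move=> efh; elim: s => //= l s IHs; apply: eq_geom_sum => n.
by rewrite !iter_div_index IHs.
Qed.

Lemma word0 s f : f 0%N = 0 -> word s f 0 = 0.
Proof.
move=> f0; elim: s => //= l s IHs.
by rewrite geom_sum0 iter_div_index IHs mulr0.
Qed.

Lemma binomial_transform_word s f :
  f 0%N = 0 -> all (fun l => l.2 == 1%N) s ->
  binomial_transform (word s f) =1 word (dual s) (binomial_transform f).
Proof.
move=> f0; elim: s => //= -[a _] s IHs /andP[/eqP-> s1] N /=.
rewrite binomial_transform_geom_sum_div ?word0 //.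
by apply: eq_geom_sum => n; rewrite /div_index IHs.
Qed.

Lemma expand_all1 z s : all (fun l => l.2 == 1%N) (expand z s).
Proof.
elim: s => //= l s IHs; rewrite all_cat IHs andbT.
by apply/allP => x /nseqP[->].
Qed.

Lemma dual_expand z s : dual (expand z s) = expand (1 - z) (dual s).
Proof.
elim: s => //= l s IHs.
by rewrite /dual map_cat map_nseq -/(dual _) IHs.
Qed.

Lemma dualK : involutive dual.
Proof.
move=> s; rewrite /dual -map_comp -[RHS]map_id; apply: eq_map => -[a k] /=.
by congr pair; ring.
Qed.

(** T_0 is the identity, so inserting it between consecutive divisions changes
    nothing. *)
Lemma word_expand s f :
  all (fun l => 0 < l.2)%N s -> word (expand 0 s) f =1 word s f.
Proof.
elim: s => //= -[a [//|k]] s IHs /= /IHs{}IHs N.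
apply: eq_geom_sum => n; rewrite /div_index; congr (_ * _).
rewrite /word foldr_cat -!/(word _ _).
elim: k n {N} => [|k IHk] n /=; first exact: IHs.
by rewrite geom_sum_zero /div_index IHk.
Qed.

Lemma binomial_transform_expand a b s :
  all (fun l => 0 < l.2)%N s ->
  binomial_transform (word s (pow_diff a b))
  =1 word (expand 1 (dual s)) (pow_diff (1 - a) (1 - b)).
Proof.
move=> s_gt0 N; rewrite -(eq_binomial_transform (word_expand _ s_gt0)).
rewrite binomial_transform_word ?expand_all1 ?pow_diff0 //.
by rewrite dual_expand subr0; apply/eq_word/binomial_transform_pow_diff.
Qed.

Lemma binomial_transform_expand_dual a b s :
  all (fun l => 0 < l.2)%N s ->
  binomial_transform (word (expand 1 (dual s)) (pow_diff (1 - a) (1 - b)))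
  =1 word s (pow_diff a b).
Proof.
move=> s_gt0 N; rewrite binomial_transform_word ?expand_all1 ?pow_diff0 //.
rewrite dual_expand subrr dualK -(word_expand _ s_gt0); apply: eq_word => n.
by rewrite binomial_transform_pow_diff /pow_diff !subKr.
Qed.

(** * Chain sums as words *)

(** The entries keep their type 'I_M.+1 while the chain bound drops from N to
    n_1, so that the lemma can be iterated; hence the two bounds M and N. *)
Lemma sum_chain_cons p M N (F : seq nat -> A) : (N <= M)%N ->
  \sum_(n : p.+1.-tuple 'I_M.+1 | chain N (ints n)) F (ints n)
  = \sum_(j < N.+1) \sum_(n : p.-tuple 'I_M.+1 | chain j (ints n))
      F (nat_of_ord j :: ints n).
Proof.
move=> leNM.
rewrite (reindex (fun x : 'I_M.+1 * p.-tuple 'I_M.+1 => [tuple of x.1 :: x.2]))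
  /=; last first.
  exists (fun n => (thead n, [tuple of behead n])) => [[i n] _ | n _] /=.
    by congr pair; apply/val_inj.
  by apply/val_inj; rewrite /= [in RHS](tuple_eta n).
rewrite -(pair_big_dep (fun i : 'I_M.+1 => i <= N)%N
  (fun (i : 'I_M.+1) (n : p.-tuple 'I_M.+1) => chain i (ints n))
  (fun i n => F (nat_of_ord i :: ints n))) /=.
by rewrite (big_ord_widen M.+1 (fun j =>
  \sum_(n : p.-tuple 'I_M.+1 | chain j (ints n)) F (j :: ints n))).
Qed.

(** The list N :: n supplies n_0 = N, so the i-th factor is a power of the gap
    n_i - n_(i+1). *)
Definition gap_prod (u : seq A) (N : nat) (n : seq nat) : A :=
  \prod_(i < size u) u`_i ^+ (nth 0%N (N :: n) i - nth 0%N n i).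

Definition weight s (N : nat) (n : seq nat) : A :=
  gap_prod (unzip1 s) N n * phi (inv_powers (unzip2 s) n).

Lemma inv_powers_cons k ks j n :
  inv_powers (k :: ks) (j :: n) = j%:R^-1 ^+ k * inv_powers ks n.
Proof.
rewrite /inv_powers big_ltn // invfM exprVn; congr (_ * _^-1).
by rewrite big_add1 /= !big_add1.
Qed.

Lemma weight_cons l s N j n :
  weight (l :: s) N (j :: n)
  = l.1 ^+ (N - j) * (phi (j%:R^-1 ^+ l.2) * weight s j n).
Proof.
rewrite /weight /gap_prod /= big_ord_recl /= inv_powers_cons rmorphM.
by rewrite -!mulrA; congr (_ * _); rewrite mulrCA.
Qed.

(** Each letter T_a D^k is the summation over one entry of the chain.  The
    condition f(0) = 0 covers the empty word: the empty list is a chain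
    from N only if N >= 1. *)
Lemma sum_chain_word s M N f : (N <= M)%N -> f 0%N = 0 ->
  \sum_(n : (size s).-tuple 'I_M.+1 | chain N (ints n))
    weight s N (ints n) * f (last N (ints n))
  = word s f N.
Proof.
move=> + f0; elim: s N => [|l s IHs] N leNM /=.
  case: N leNM => [|N] leNM.
    by rewrite big_pred0 // => n; rewrite tuple0.
  rewrite (big_pred1 [tuple]) /=; last by move=> n; rewrite [n]tuple0 [RHS]eqxx.
  by rewrite /weight /gap_prod /inv_powers big_ord0 big_geq // invr1 rmorph1 !mul1r.
rewrite (sum_chain_cons _ (fun n => weight (l :: s) N n * f (last N n))) //.
apply: eq_bigr => j _.
have le_j : (j <= M)%N by apply: leq_trans leNM; rewrite -ltnS.
rewrite iter_div_index -IHs // !mulr_sumr; apply: eq_bigr => n _.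
by rewrite weight_cons !mulrA.
Qed.

(** A coefficient depending on n_1 replaces the outer summation T_1; what is
    left inside begins with T_0, the identity.  The cases c = 1 and
    c = [signed_bin N] are the two kinds of sums to be compared. *)
Lemma sum_chain_first (c : nat -> A) k s N f : f 0%N = 0 ->
  \sum_(n : (size s).+1.-tuple 'I_N.+1 | chain N (ints n))
    c (entry (ints n) 1) *
      (weight ((1, k) :: s) N (ints n) * f (last N (ints n)))
  = \sum_(j < N.+1) c j * word ((0, k) :: s) f j.
Proof.
move=> f0; rewrite (sum_chain_cons _ (fun n => c (entry n 1) *
  (weight ((1, k) :: s) N n * f (last N n)))) //.
apply: eq_bigr => j _; have le_j : (j <= N)%N by rewrite -ltnS.
rewrite /= geom_sum_zero iter_div_index -(sum_chain_word _ le_j) // !mulr_sumr.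
by apply: eq_bigr => n _; rewrite weight_cons expr1n mul1r !mulrA.
Qed.

(** * Powers of the variables in the two chain sums *)

Lemma prod_exp_cat (u v : seq A) (e : nat -> nat) :
  \prod_(i < size (u ++ v)) (u ++ v)`_i ^+ e i
  = (\prod_(i < size u) u`_i ^+ e i)
    * \prod_(i < size v) v`_i ^+ e (size u + i)%N.
Proof.
rewrite size_cat big_split_ord /=; congr (_ * _); apply: eq_bigr => i _.
  by rewrite nth_cat ltn_ord.
by rewrite nth_cat ltnNge leq_addr addKn.
Qed.

(** The fillers contribute powers of 1, and, counting from 0, letter i of s
    sits at position k_1 + ... + k_i of its expansion. *)
Lemma prod_exp_expand s (e : nat -> nat) : all (fun l => 0 < l.2)%N s ->
  \prod_(i < size (unzip1 (expand 1 s))) (unzip1 (expand 1 s))`_i ^+ e i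
  = \prod_(i < size (unzip1 s)) (unzip1 s)`_i ^+ e (psum (unzip2 s) i).
Proof.
elim: s e => [|[a [//|k]] s IHs] e /=; first by rewrite !big_ord0.
move=> s_gt0; rewrite /unzip1 map_cat map_nseq -!/(unzip1 _) /=.
rewrite big_ord_recl [RHS]big_ord_recl /=; congr (_ * _).
rewrite (prod_exp_cat _ _ (fun i => e i.+1)) big1 ?mul1r; last first.
  by case=> j /=; rewrite size_nseq => lejk _; rewrite nth_nseq lejk expr1n.
by rewrite (IHs (fun i => e (size (nseq k 1%R : seq A) + i).+1)) // size_nseq.
Qed.

Lemma unzip2_expand z s : all (fun l => 0 < l.2)%N s ->
  unzip2 (expand z s) = nseq (sumn (unzip2 s)) 1%N.
Proof.
elim: s => [|[a [//|k]] s IHs] //= /IHs E.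
by rewrite /unzip2 map_cat map_nseq -/(unzip2 (expand z s)) E -nseqD.
Qed.

Lemma inv_powers_ones n : inv_powers (nseq (size n) 1%N) n = inv_prod n.
Proof.
rewrite /inv_powers /inv_prod size_nseq; congr (_^-1).
apply: eq_big_nat => i /andP[i_gt0 leni]; rewrite /entry nth_nseq.
by case: i i_gt0 leni => // i _; rewrite ltnS /= => ->.
Qed.

Lemma last_chain_gt0 N n : chain N n -> (0 < last N n)%N.
Proof. by rewrite /chain rcons_path => /andP[]. Qed.

Section Letters.

Variables (t : nat -> A) (k0 : nat) (k : seq nat).

(** The letters after the first one.  With t_1, t_2, ... numbered from 1, the
    exponent k_(i+1) goes with t_i; the first letter, which carries k_1, is 0
    or 1. *)
Definition tail_letters : seq (A * nat) :=
  zip (mkseq (fun i => t i.+1) (size k)) k.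

Lemma unzip1_tail_letters : unzip1 tail_letters = mkseq (fun i => t i.+1) (size k).
Proof. by rewrite unzip1_zip // size_mkseq. Qed.

Lemma unzip2_tail_letters : unzip2 tail_letters = k.
Proof. by rewrite unzip2_zip // size_mkseq. Qed.

Lemma size_tail_letters : size tail_letters = size k.
Proof. by rewrite size_zip size_mkseq minnn. Qed.

Lemma tail_letters_gt0 :
  all (fun j => 0 < j)%N k -> all (fun l => 0 < l.2)%N tail_letters.
Proof. by rewrite -{1}unzip2_tail_letters all_map. Qed.

Lemma prod_exp_letters (e : nat -> nat) :
  \prod_(i < (size (unzip1 tail_letters)).+1)
    (1 :: unzip1 tail_letters)`_i ^+ e i
  = \prod_(1 <= i < (size k).+1) t i ^+ e i.
Proof.
rewrite unzip1_tail_letters big_ord_recl /= expr1n mul1r size_mkseq.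
rewrite big_add1 big_mkord; apply: eq_bigr => i _.
by rewrite nth_mkseq add0n ?ltn_ord.
Qed.

Lemma weight_letters N n :
  weight ((1, k0) :: tail_letters) N n
  = (\prod_(1 <= i < (size k).+1) t i ^+ (entry n i - entry n i.+1))
    * phi (inv_powers (k0 :: k) n).
Proof.
rewrite /weight /gap_prod /= unzip2_tail_letters; congr (_ * _).
rewrite (prod_exp_letters (fun i => nth 0%N (N :: n) i - nth 0%N n i)%N).
by apply: eq_big_nat => -[].
Qed.

Lemma weight_expand_letters N n : (0 < k0)%N -> all (fun j => 0 < j)%N k ->
  size n = sumn (k0 :: k) ->
  weight (expand 1 ((1, k0) :: tail_letters)) N n
  = (\prod_(1 <= i < (size k).+1)
       t i ^+ (entry n (psum (k0 :: k) i) - entry n (psum (k0 :: k) i).+1))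
    * phi (inv_prod n).
Proof.
move=> k0_gt0 k_gt0 szn.
have s_gt0 : all (fun l => 0 < l.2)%N ((1, k0) :: tail_letters).
  by rewrite /= k0_gt0 tail_letters_gt0.
have exps : unzip2 (expand 1 ((1, k0) :: tail_letters)) = nseq (size n) 1%N.
  by rewrite unzip2_expand // szn /unzip2 /= -/(unzip2 _) unzip2_tail_letters.
rewrite /weight exps inv_powers_ones; congr (_ * _); rewrite /gap_prod.
rewrite (prod_exp_expand (fun i => nth 0%N (N :: n) i - nth 0%N n i)%N s_gt0) /=.
rewrite unzip2_tail_letters.
rewrite (prod_exp_letters (fun i => nth 0%N (N :: n) (psum (k0 :: k) i)
  - nth 0%N n (psum (k0 :: k) i))%N).
apply: eq_big_nat => -[//|i] _; congr (_ ^+ (_ - _)).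
by rewrite /psum /=; case: k0 k0_gt0.
Qed.

End Letters.

Lemma dual_tail_letters (t : nat -> A) k :
  dual (tail_letters t k) = tail_letters (fun i => 1 - t i) k.
Proof.
rewrite /dual /tail_letters /mkseq; elim: k 0%N => //= j k IHk i.
by rewrite IHk.
Qed.

(** * The two sides and their duality *)

(** The last entry of a chain is positive, so subtracting 0^n from the innermost
    power t_m^n does not change the sum. *)
Lemma sum_compressed (c : nat -> rat) (t : nat -> A) k0 k m' N : size k = m' ->
  \sum_(n : m'.+1.-tuple 'I_N.+1 | chain N (ints n))
    phi (c (entry (ints n) 1) * inv_powers (k0 :: k) (ints n)) *
    ((\prod_(1 <= i < m'.+1)
        t i ^+ (entry (ints n) i - entry (ints n) i.+1))
     * t m'.+1 ^+ entry (ints n) m'.+1)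
  = \sum_(j < N.+1) phi (c j)
      * word ((0, k0) :: tail_letters t k) (pow_diff (t m'.+1) 0) j.
Proof.
move=> <-.
rewrite -(sum_chain_first (fun j => phi (c j)) _ _ _ (pow_diff0 _ _)).
rewrite size_tail_letters; apply: eq_bigr => n chn.
rewrite weight_letters /pow_diff expr0n.
have := last_chain_gt0 chn.
rewrite (last_nth 0%N) size_map size_tuple /= -/(entry _ (size k).+1).
case: (entry _ (size k).+1) => // e _; rewrite subr0 rmorphM; ring.
Qed.

Lemma sum_expanded (c : nat -> rat) (t : nat -> A) k0 k m' N : size k = m' ->
  (0 < k0)%N -> all (fun j => 0 < j)%N k ->
  \sum_(n : (sumn (k0 :: k)).-tuple 'I_N.+1 | chain N (ints n))
    phi (c (entry (ints n) 1) * inv_prod (ints n)) *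
    ((\prod_(1 <= i < m'.+1)
        t i ^+ (entry (ints n) (psum (k0 :: k) i)
                - entry (ints n) (psum (k0 :: k) i).+1))
     * (t m'.+1 ^+ entry (ints n) (sumn (k0 :: k)) - 1))
  = \sum_(j < N.+1) phi (c j)
      * word (expand 1 ((0, k0) :: tail_letters t k)) (pow_diff (t m'.+1) 1) j.
Proof.
move=> <- k0_gt0 k_gt0.
pose r := nseq k0.-1 (1 : A, 1%N) ++ expand 1 (tail_letters t k).
rewrite -(sum_chain_first (fun j => phi (c j)) 1 r _ (pow_diff0 _ _)).
have szr : (size r).+1 = sumn (k0 :: k).
  have := unzip2_expand 1 (_ : all (fun l => 0 < l.2)%N ((1, k0) :: tail_letters t k)).
  rewrite /= k0_gt0 tail_letters_gt0 // => /(_ isT)/(congr1 size).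
  by rewrite size_nseq /= size_map unzip2_tail_letters.
rewrite szr; apply: eq_bigr => n chn.
rewrite -[(1, 1%N) :: r]/(expand 1 ((1, k0) :: tail_letters t k)).
rewrite weight_expand_letters ?size_map ?size_tuple //.
rewrite /pow_diff expr1n (last_nth 0%N) size_map size_tuple.
have -> : nth 0%N (N :: ints n) (sumn (k0 :: k)) = entry (ints n) (sumn (k0 :: k)).
  by case: (sumn _) szr (ints n).
by rewrite rmorphM; ring.
Qed.

(** In the first identity the leading T_0 becomes T_1 under B; in the second
    one the leading T_0 is itself the image of the T_1 that sums the left
    word. *)
Lemma compressed_expanded_duality (t : nat -> A) a k0 k N :
  (0 < k0)%N -> all (fun j => 0 < j)%N k ->
  let left_word := word ((0, k0) :: tail_letters t k) (pow_diff a 0) in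
  let right_word := word (expand 1 ((0, k0) :: tail_letters (fun i => 1 - t i) k))
                      (pow_diff (1 - a) 1) in
  binomial_transform left_word N = \sum_(j < N.+1) right_word j
  /\ \sum_(j < N.+1) left_word j = binomial_transform right_word N.
Proof.
move=> k0_gt0 k_gt0 left_word right_word.
have s_gt0 x : all (fun l => 0 < l.2)%N ((x, k0) :: tail_letters t k).
  by rewrite /= k0_gt0 tail_letters_gt0.
have first_letter l s f :
    \sum_(j < N.+1) word ((0, l) :: s) f j = word ((1, l) :: s) f N.
  rewrite /= geom_sum_one; apply: eq_bigr => j _; exact: geom_sum_zero.
have dualE x : dual ((x, k0) :: tail_letters t k)
    = (1 - x, k0) :: tail_letters (fun i => 1 - t i) k.
  by rewrite -dual_tail_letters.
split.
  rewrite binomial_transform_expand // dualE !subr0.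
  exact/esym/first_letter.
rewrite first_letter -(binomial_transform_expand_dual _ _ (s_gt0 1)).
by rewrite dualE subrr subr0.
Qed.

End Words.

Theorem theorem2p5 (R : comAlgType rat) (m' : nat) (k : m'.+1.-tuple nat)
    (N : nat) (hk : forall i : 'I_m'.+1, (0 < tnth k i)%N) (hN : (0 < N)%N) :
  (\sum_(n : m'.+1.-tuple 'I_N.+1 | chain N (ints n))
      ((sbin N (ints n) * inv_powers k (ints n))%:A : R)
        *: tmono R m' (ints n)
   = \sum_(n : (sumn k).-tuple 'I_N.+1 | chain N (ints n))
      ((inv_prod (ints n))%:A : R) *: one_sub_tmono R m' k (ints n))
  /\
  (\sum_(n : m'.+1.-tuple 'I_N.+1 | chain N (ints n))
      ((inv_powers k (ints n))%:A : R) *: tmono R m' (ints n)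
   = \sum_(n : (sumn k).-tuple 'I_N.+1 | chain N (ints n))
      ((sbin N (ints n) * inv_prod (ints n))%:A : R)
        *: one_sub_tmono R m' k (ints n)).
Proof.
(* The scalars of both sides are images of rationals in the polynomial ring. *)
pose phi : {rmorphism rat -> {mpoly R[m'.+1]}} :=
  @mpolyC m'.+1 R \o GRing.in_alg R.
have scaleE (q : rat) (p : {mpoly R[m'.+1]}) : (q%:A : R) *: p = phi q * p.
  by rewrite -mul_mpolyC.
have all_k : all (fun j => 0 < j)%N k.
  by apply/all_tnthP.
case: k hk all_k => -[//|k0 k] /= szk _ /andP[k0_gt0 k_gt0].
have {}szk : size k = m' by case/eqP: szk.
pose t := tvar R m'; pose u i := 1 - t i.
pose sgn j : rat := (-1) ^+ j * 'C(N, j)%:R.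
have psumm : psum (k0 :: k) m'.+1 = sumn (k0 :: k).
  by rewrite /psum take_oversize //= szk.
have phi_sbin j : phi (sgn j) = signed_bin {mpoly R[m'.+1]} N j.
  by rewrite rmorphM rmorphXn rmorphN1 rmorph_nat.
have [E1 E2] := compressed_expanded_duality phi t (t m'.+1) N k0_gt0 k_gt0.
have compressedE c := sum_compressed phi c t k0 N szk.
have expandedE c := sum_expanded phi c u N szk k0_gt0 k_gt0.
have binE (f : nat -> {mpoly R[m'.+1]}) : \sum_(j < N.+1) phi (sgn j) * f j
    = binomial_transform f N.
  by apply: eq_bigr => j _; rewrite phi_sbin.
have oneE (f : nat -> {mpoly R[m'.+1]}) : \sum_(j < N.+1) phi 1 * f j
    = \sum_(j < N.+1) f j.
  by apply: eq_bigr => j _; rewrite rmorph1 mul1r.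
split.
  transitivity (binomial_transform (word phi ((0, k0) :: tail_letters t k)
      (pow_diff (t m'.+1) 0)) N).
    rewrite -binE -(compressedE sgn); apply: eq_bigr => n _; exact: scaleE.
  rewrite E1 -oneE -(expandedE (fun=> 1)); apply: eq_bigr => n _.
  by rewrite scaleE mul1r /one_sub_tmono psumm.
transitivity (\sum_(j < N.+1) word phi ((0, k0) :: tail_letters t k)
    (pow_diff (t m'.+1) 0) j).
  rewrite -oneE -(compressedE (fun=> 1)); apply: eq_bigr => n _.
  by rewrite scaleE mul1r.
rewrite E2 -binE -(expandedE sgn); apply: eq_bigr => n _.
by rewrite scaleE /one_sub_tmono psumm.
Qed.
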